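(* Fix $\rho\in(0,1)$ and let $\nu=1+\varepsilon$ with $\varepsilon>0$. As $\varepsilon\downarrow0$: (a) $p^*\sim\dfrac{\varepsilon}{2\rho}$ and $u^*_{\mathrm{RR}}=(\sqrt\nu-1)^2\sim\dfrac{\varepsilon^2}{4}$ (the equality holding for all sufficiently small $\varepsilon$). (b) $\sigma^*\sim\dfrac{\varepsilon}{\log(1/\varepsilon)+\log\log(1/\varepsilon)}$ and $u^*_{\mathrm{GA}}\sim\dfrac{\varepsilon}{\log(1/\varepsilon)+\log\log(1/\varepsilon)}$. (c) $\mathrm{PoF}(\rho,\nu)\sim\dfrac{4}{\varepsilon\bigl(\log(1/\varepsilon)+\log\log(1/\varepsilon)\bigr)}\to\infty$. Here $k(\varepsilon)\sim h(\varepsilon)$ means $k(\varepsilon)/h(\varepsilon)\to1$ as $\varepsilon\downarrow0$.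
   Context: A single-server queue has Poisson potential arrivals of rate $\rho\in(0,1)$, exponential service with rate $1$, reward $\nu$ per served customer, and holding cost $1$ per customer per unit time in system. Random routing (RR): each arrival is admitted independently with probability $p\in[0,1]$. The stationary welfare per unit time is $u(\pi_p)=\rho p\,\nu-\frac{\rho p}{1-\rho p}$. Let $p^*$ be its maximizer over $[0,1]$ and $u^*_{\mathrm{RR}}(\rho,\nu)$ its maximum. Gated admission (GA): after each admission, arrivals are blocked for $\tau$ time units. For $0\le\tau<\infty$ the stationary welfare per unit time is $$u(\pi_\tau)=\frac{\rho}{1+\rho\tau}\left(\nu-\frac{1}{1-\sigma(\tau)}\right),$$ where $\sigma(\tau)\in(0,1)$ is the smallest positive solution of $\sigma=\frac{\rho e^{-(1-\sigma)\tau}}{\rho+1-\sigma}$. Let $\tau^*$ be its maximizer over $\tau\ge0$, $\sigma^*:=\sigma(\tau^* )$, and $u^*_{\mathrm{GA}}(\rho,\nu):=u(\pi_{\tau^*})$. The price of forgetting is $\mathrm{PoF}(\rho,\nu):=u^*_{\mathrm{GA}}(\rho,\nu)/u^*_{\mathrm{RR}}(\rho,\nu)$. *)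

(* Defs.v *)
From Stdlib Require Export Reals ClassicalEpsilon.
From Coquelicot Require Export Coquelicot.

Local Open Scope R_scope.

Definition is_argmax (D : R -> Prop) (f : R -> R) (x : R) : Prop :=
  D x /\ forall y : R, D y -> f y <= f x.

(** Hilbert choice of a maximizer, with no specified value if there is none.
    Both instances below have exactly one maximizer when [0 < rho < 1 < nu]. *)
Definition argmax (D : R -> Prop) (f : R -> R) : R :=
  epsilon (inhabits 0) (is_argmax D f).

Definition u_RR (rho nu p : R) : R :=
  rho * p * nu - rho * p / (1 - rho * p).

Definition p_star (rho nu : R) : R :=
  argmax (fun p => 0 <= p <= 1) (u_RR rho nu).

Definition u_RR_star (rho nu : R) : R := u_RR rho nu (p_star rho nu).

Definition sigma_eqn (rho tau s : R) : Prop :=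
  s = rho * exp (- (1 - s) * tau) / (rho + 1 - s).

(** [s = 1] always solves [sigma_eqn] when [rho <> 0]; minimality excludes it
    when [0 < rho < 1] and [0 <= tau], since a solution in (0,1) then exists. *)
Definition is_sigma (rho tau s : R) : Prop :=
  0 < s < 1 /\ sigma_eqn rho tau s /\
  forall s' : R, 0 < s' -> sigma_eqn rho tau s' -> s <= s'.

Definition sigma (rho tau : R) : R :=
  epsilon (inhabits 0) (is_sigma rho tau).

Definition u_GA (rho nu tau : R) : R :=
  rho / (1 + rho * tau) * (nu - 1 / (1 - sigma rho tau)).

Definition tau_star (rho nu : R) : R :=
  argmax (fun tau => 0 <= tau) (u_GA rho nu).

Definition sigma_star (rho nu : R) : R := sigma rho (tau_star rho nu).

Definition u_GA_star (rho nu : R) : R := u_GA rho nu (tau_star rho nu).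

Definition PoF (rho nu : R) : R := u_GA_star rho nu / u_RR_star rho nu.

Definition equiv_at_0plus (k h : R -> R) : Prop :=
  filterlim (fun eps => k eps / h eps) (at_right 0) (locally 1).

(* Main.v *)
Require Import Defs.
From Stdlib Require Import Reals.
From Stdlib Require Import Lra.
From Coquelicot Require Import Coquelicot.
Open Scope R_scope.

(** Parametrize gated admission by [s = sigma tau] instead of [tau]: the map
    [sigma] is inverse to the decreasing bijection [T : (0, rho] -> [0, +oo)],
    [T s = (ln (rho / (rho + 1 - s)) - ln s) / (1 - s)], and the welfare
    becomes [N / H] with [N = eps - s / (1 - s)] and [H = / rho + T s].
    A maximizer [s] lies in [(0, eps)], and the first-order condition there
    reads [s H = A N] with [A = - s (1 - s)^2 T'(s) -> 1] as [s -> 0].  Hence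
    the optimal welfare is exactly [s / A], and [eps = s l R(s)] with
    [l = - ln s] and [R -> 1].  Taking logarithms,
    [- ln eps = l - ln l - ln R ~ l], so [s ~ eps / - ln eps]; the [ln ln]
    correction in the denominator is of lower order than [ln (1 / eps)].
    For random routing, completing the square gives
    [u = (sqrt nu - 1)^2 - (sqrt nu (1 - x) - 1)^2 / (1 - x)], [x = rho p]. *)

(** * Elementary bounds on logarithm and square root; maximizers by choice *)

Lemma ln_le_sub_1 (x : R) : 0 < x -> ln x <= x - 1.
Proof.
intros Hx.
destruct (Req_dec (ln x) 0) as [H0|H0].
- rewrite <- (exp_ln x Hx) at 2. rewrite H0, exp_0. lra.
- generalize (exp_ineq1 _ H0). rewrite exp_ln by easy. lra.
Qed.

Lemma ln_lt_sub_1 (x : R) : 0 < x -> x <> 1 -> ln x < x - 1.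
Proof.
intros Hx H1.
assert (H0 : ln x <> 0) by (intros H; apply H1, ln_inv; [easy | lra | now rewrite ln_1]).
generalize (exp_ineq1 _ H0). rewrite exp_ln by easy. lra.
Qed.

Lemma ln_neg (x : R) : 0 < x < 1 -> ln x < 0.
Proof. intros Hx. rewrite <- ln_1. apply ln_increasing; lra. Qed.

Lemma sqrt_gt_1 (x : R) : 1 < x -> 1 < sqrt x.
Proof. intros Hx. rewrite <- sqrt_1. apply sqrt_lt_1; lra. Qed.

Lemma argmax_spec (D : R -> Prop) (f : R -> R) :
  (exists x, is_argmax D f x) -> is_argmax D f (argmax D f).
Proof. intros H. exact (epsilon_spec _ _ H). Qed.

(** * Random routing: the optimal admission probability in closed form *)

Section Random_routing.

Variables rho nu : R.
Hypothesis Hrho : 0 < rho < 1.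
Hypothesis Hnu : 1 < nu.
Hypothesis Hint : 1 - / sqrt nu <= rho.

(** The subtracted square vanishes exactly when [1 - rho * p = / sqrt nu], so both the maximizer and
    the maximum can be read off. *)
Lemma u_RR_square (p : R) : rho * p < 1 ->
  u_RR rho nu p =
  (sqrt nu - 1) ^ 2 - (sqrt nu * (1 - rho * p) - 1) ^ 2 / (1 - rho * p).
Proof.
intros Hp. unfold u_RR.
rewrite <- (sqrt_sqrt nu) at 1 by lra.
field. lra.
Qed.

(** [Hint] says that the zero [p0] of the square is at most 1, hence feasible. As [p_star] is known
    only through being a maximizer, uniqueness has to be shown as well. *)
Lemma p_star_eq : p_star rho nu = (1 - / sqrt nu) / rho.
Proof.
assert (Hs : 1 < sqrt nu) by (apply sqrt_gt_1; lra).
assert (Hi : 0 < / sqrt nu < 1).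
{ split; [apply Rinv_0_lt_compat; lra|]. rewrite <- Rinv_1. apply Rinv_lt_contravar; lra. }
set (p0 := (1 - / sqrt nu) / rho).
assert (Hp0 : 0 <= p0 <= 1).
{ unfold p0; split.
  - apply Rdiv_le_0_compat; lra.
  - apply Rle_div_l; lra. }
assert (Ep0 : rho * p0 = 1 - / sqrt nu) by (unfold p0; field; lra).
assert (Hlt : forall p, 0 <= p <= 1 -> rho * p < 1) by (intros; nra).
assert (Hv : u_RR rho nu p0 = (sqrt nu - 1) ^ 2).
{ rewrite u_RR_square, Ep0 by auto. field. lra. }
assert (Hle : forall p, 0 <= p <= 1 -> u_RR rho nu p <= u_RR rho nu p0).
{ intros p Hp. rewrite Hv, u_RR_square by auto.
  assert (0 <= (sqrt nu * (1 - rho * p) - 1) ^ 2 / (1 - rho * p)); [|lra].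
  apply Rdiv_le_0_compat; [apply pow2_ge_0 | specialize (Hlt p Hp); lra]. }
destruct (argmax_spec (fun p => 0 <= p <= 1) (u_RR rho nu)) as [Hd Hm].
{ exists p0. now split. }
fold (p_star rho nu) in Hd, Hm.
specialize (Hm p0 Hp0). specialize (Hlt _ Hd).
rewrite Hv, u_RR_square in Hm by easy.
set (y := sqrt nu * (1 - rho * p_star rho nu) - 1) in Hm.
(* The chosen maximizer does at least as well as [p0], where the square vanishes; a nonzero [y]
   would make it strictly worse. *)
assert (Hy : y = 0).
{ destruct (Req_dec y 0) as [|Hy]; [easy|exfalso].
  assert (0 < y ^ 2 / (1 - rho * p_star rho nu)); [|lra].
  apply Rdiv_lt_0_compat; [now apply pow2_gt_0 | lra]. }
unfold y in Hy.
assert (E : 1 - rho * p_star rho nu = / sqrt nu).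
{ apply Rmult_eq_reg_l with (sqrt nu); [|lra]. rewrite Rinv_r; lra. }
unfold p0. rewrite <- E. field. lra.
Qed.

Lemma u_RR_star_eq : u_RR_star rho nu = (sqrt nu - 1) ^ 2.
Proof.
assert (Hs : 1 < sqrt nu) by (apply sqrt_gt_1; lra).
assert (E : rho * p_star rho nu = 1 - / sqrt nu) by (rewrite p_star_eq; field; lra).
assert (Hi : 0 < / sqrt nu) by (apply Rinv_0_lt_compat; lra).
unfold u_RR_star. rewrite u_RR_square, E by lra. field. lra.
Qed.

End Random_routing.

(** * Gated admission, parametrized by the root [s] of the equation for [sigma] *)

Definition gate (rho s : R) : R :=
  (ln (rho / (rho + 1 - s)) - ln s) / (1 - s).

(** The quantity [- s (1 - s)^2 T'(s)], where [T] is [gate rho]. *)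
Definition gate_slope (rho s : R) : R :=
  (1 - s) * (1 - s * / (rho + 1 - s)) - s * (ln (rho / (rho + 1 - s)) - ln s).

Section Gate.

Variable rho : R.
Hypothesis Hrho : 0 < rho < 1.

Lemma gate_is_derive (s : R) : 0 < s < 1 ->
  is_derive (gate rho) s (- gate_slope rho s / (s * (1 - s) ^ 2)).
Proof.
intros Hs. unfold gate, gate_slope.
assert (0 < rho / (rho + 1 - s)) by (apply Rdiv_lt_0_compat; lra).
auto_derive.
- repeat split; try lra. exact H.
- unfold Rdiv, Rminus. field. lra.
Qed.

Lemma gate_continuous (s : R) : 0 < s < 1 -> continuity_pt (gate rho) s.
Proof.
intros Hs. apply continuity_pt_filterlim.
apply (ex_derive_continuous (gate rho)). eexists. now apply gate_is_derive.
Qed.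

(** Apply [ln x <= x - 1] to [rho / (rho + 1 - s)] and, strictly, to [/ s]: the two bounds, added
    and multiplied by [s], give exactly the first product in [gate_slope]. *)
Lemma gate_slope_pos (s : R) : 0 < s < 1 -> 0 < gate_slope rho s.
Proof.
intros Hs. unfold gate_slope.
assert (Ha : ln (rho / (rho + 1 - s)) <= rho / (rho + 1 - s) - 1).
{ apply ln_le_sub_1, Rdiv_lt_0_compat; lra. }
assert (Hb : - ln s < / s - 1).
{ rewrite <- ln_Rinv by lra. apply ln_lt_sub_1.
  - apply Rinv_0_lt_compat; lra.
  - intros H. assert (s = 1) by (rewrite <- (Rinv_inv s), H; field). lra. }
assert (Hc : s * (ln (rho / (rho + 1 - s)) - ln s)
             < s * (rho / (rho + 1 - s) - 1 + (/ s - 1))).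
{ apply Rmult_lt_compat_l; lra. }
replace ((1 - s) * (1 - s * / (rho + 1 - s)))
  with (s * (rho / (rho + 1 - s) - 1 + (/ s - 1))); [lra|].
field. lra.
Qed.

Lemma gate_decr (s t : R) : 0 < s -> s < t -> t < 1 -> gate rho t < gate rho s.
Proof.
intros Hs Hst Ht.
destruct (MVT_gen (gate rho) s t (fun s => - gate_slope rho s / (s * (1 - s) ^ 2)))
  as [c [Hc E]]; try (rewrite Rmin_left, Rmax_right by lra; intros).
- apply gate_is_derive. lra.
- apply gate_continuous. lra.
- rewrite Rmin_left, Rmax_right in Hc by lra.
  assert (0 < gate_slope rho c / (c * (1 - c) ^ 2)).
  { apply Rdiv_lt_0_compat; [apply gate_slope_pos; lra|].
    apply Rmult_lt_0_compat; [lra|]. apply pow_lt. lra. }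
  unfold Rdiv in *. nra.
Qed.

Lemma gate_rho : gate rho rho = 0.
Proof.
unfold gate. replace (rho / (rho + 1 - rho)) with rho by (field; lra).
field. lra.
Qed.

Lemma gate_ge_0 (s : R) : 0 < s <= rho -> 0 <= gate rho s.
Proof.
intros Hs. destruct (Req_dec s rho) as [->|].
- rewrite gate_rho. lra.
- rewrite <- gate_rho. apply Rlt_le, gate_decr; lra.
Qed.

Lemma gate_inj (s t : R) : 0 < s < 1 -> 0 < t < 1 -> gate rho s = gate rho t -> s = t.
Proof.
intros Hs Ht E. destruct (Rtotal_order s t) as [H|[H|H]]; [|easy|].
- generalize (gate_decr s t). lra.
- generalize (gate_decr t s). lra.
Qed.

(** After taking logarithms the equation is linear in [tau], and [gate] is its solution. *)
Lemma sigma_eqn_gate (tau s : R) : 0 < s < 1 ->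
  sigma_eqn rho tau s <-> gate rho s = tau.
Proof.
intros Hs. unfold sigma_eqn, gate.
assert (Hq : 0 < rho / (rho + 1 - s)) by (apply Rdiv_lt_0_compat; lra).
replace (rho * exp (- (1 - s) * tau) / (rho + 1 - s))
  with (rho / (rho + 1 - s) * exp (- (1 - s) * tau)) by (field; lra).
split; intros H.
- assert (E : ln s = ln (rho / (rho + 1 - s)) + - (1 - s) * tau).
  { rewrite H at 1. rewrite ln_mult, ln_exp; [easy|easy|apply exp_pos]. }
  rewrite E. field. lra.
- rewrite <- H.
  rewrite <- (exp_ln _ Hq) at 1. rewrite <- exp_plus.
  rewrite <- (exp_ln s) at 1 by lra. f_equal. field. lra.
Qed.

(** [gate] blows up at 0, so the intermediate value theorem is applied to the equation with
    denominators cleared, which is continuous on all of [[0, rho]]: [g] is negative at 0 and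
    nonnegative at [rho]. *)
Lemma gate_surj (tau : R) : 0 <= tau -> exists s, 0 < s <= rho /\ gate rho s = tau.
Proof.
intros Ht.
set (g := fun s => s * (rho + 1 - s) - rho * exp (- (1 - s) * tau)).
destruct (IVT_cor g 0 rho) as [s [Hs E]].
- unfold g. apply derivable_continuous. intros x.
  apply ex_derive_Reals_0. auto_derive. easy.
- lra.
- unfold g.
  assert (0 < exp (- (1 - 0) * tau)) by apply exp_pos.
  assert (exp (- (1 - rho) * tau) <= 1).
  { rewrite <- exp_0 at 2. apply Rnot_lt_le; intros Hlt. apply exp_lt_inv in Hlt.
    assert (0 <= (1 - rho) * tau) by (apply Rmult_le_pos; lra). lra. }
  assert (0 <= rho * (1 - exp (- (1 - rho) * tau))) by (apply Rmult_le_pos; lra).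
  assert (0 < rho * exp (- (1 - 0) * tau)) by (apply Rmult_lt_0_compat; lra).
  replace (rho * (rho + 1 - rho)) with rho by ring.
  nra.
- unfold g in E.
  assert (Hp : 0 < rho * exp (- (1 - s) * tau)).
  { apply Rmult_lt_0_compat; [lra|apply exp_pos]. }
  assert (0 < s) by (destruct (Req_dec s 0) as [->|]; lra).
  exists s. split; [lra|]. apply sigma_eqn_gate; [lra|].
  unfold sigma_eqn. apply Rmult_eq_reg_r with (rho + 1 - s); [|lra].
  field_simplify; lra.
Qed.

(** In [(0, 1)] the root is unique by injectivity of [gate], and any other positive root is at least
    1; so [s] is the smallest one and the choice operator must return it. *)
Lemma sigma_gate (s : R) : 0 < s <= rho -> Defs.sigma rho (gate rho s) = s.
Proof.
intros Hs.
assert (H : is_sigma rho (gate rho s) (Defs.sigma rho (gate rho s))).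
{ apply (epsilon_spec (inhabits 0) (is_sigma rho (gate rho s))). exists s. split; [lra|]. split.
  - apply sigma_eqn_gate; [lra|easy].
  - intros s' Hs' E. destruct (Rlt_le_dec s' 1) as [H1|]; [|lra].
    apply sigma_eqn_gate in E; [|lra].
    apply Req_le, gate_inj; lra. }
destruct H as [H0 [H1 _]].
apply sigma_eqn_gate in H1; [|easy].
apply gate_inj; lra.
Qed.

(** Divide through by [rho] and use [1 - 1 / (1 - s) = - s / (1 - s)]. *)
Lemma u_GA_gate (eps s : R) : 0 < s <= rho ->
  u_GA rho (1 + eps) (gate rho s)
  = (eps - s / (1 - s)) / (/ rho + gate rho s).
Proof.
intros Hs. unfold u_GA. rewrite sigma_gate by easy.
generalize (gate_ge_0 s Hs); intros HT.
field. repeat split; nra.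
Qed.

Lemma u_GA_gate_pos (eps s : R) : 0 < s <= rho -> s / (1 - s) < eps ->
  0 < u_GA rho (1 + eps) (gate rho s).
Proof.
intros Hs H. rewrite u_GA_gate by easy.
generalize (gate_ge_0 s Hs); intros HT.
assert (0 < / rho) by (apply Rinv_0_lt_compat; lra).
apply Rdiv_lt_0_compat; lra.
Qed.

(** A trial point with positive welfare, which bounds the optimum away from 0; the inequality
    amounts to [eps < 1]. *)
Lemma half_eps_feasible (eps : R) : 0 < eps < rho ->
  0 < eps / 2 <= rho /\ eps / 2 / (1 - eps / 2) < eps.
Proof.
intros He. split; [lra|]. apply Rlt_div_l; nra.
Qed.

Lemma gate_quotient_continuous (eps s : R) : 0 < s <= rho ->
  continuity_pt (fun s => (eps - s / (1 - s)) / (/ rho + gate rho s)) s.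
Proof.
intros Hs. apply continuity_pt_div.
- apply derivable_continuous_pt, ex_derive_Reals_0. auto_derive. lra.
- apply continuity_pt_plus; [apply continuity_pt_const; easy|].
  apply gate_continuous. lra.
- generalize (gate_ge_0 s Hs).
  assert (0 < / rho) by (apply Rinv_0_lt_compat; lra). lra.
Qed.

(** The range [(0, rho]] of [s] is not compact, but the welfare becomes small as [s] tends to 0, so
    the maximum over a compact subinterval is the global one. *)
Lemma u_GA_argmax_exists (eps : R) : 0 < eps < rho ->
  exists tau, is_argmax (fun tau => 0 <= tau) (u_GA rho (1 + eps)) tau.
Proof.
intros He.
destruct (half_eps_feasible eps He) as [H1 H2].
set (s1 := eps / 2) in *.
set (v := u_GA rho (1 + eps) (gate rho s1)).
assert (Hv : 0 < v) by now apply u_GA_gate_pos.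
(* To the left of [s2] the denominator exceeds [eps / v] while the numerator stays below [eps], so
   the welfare is below the value [v] reached at [s1]. *)
destruct (gate_surj (eps / v)) as [s2 [Hs2 E2]].
{ apply Rlt_le, Rdiv_lt_0_compat; lra. }
assert (Hm : 0 < Rmin s1 s2 <= rho).
{ split; [apply Rmin_case; lra | apply Rle_trans with (1 := Rmin_l _ _); lra]. }
set (f := fun s => (eps - s / (1 - s)) / (/ rho + gate rho s)).
destruct (continuity_ab_maj f (Rmin s1 s2) rho) as [s0 [Hmax Hs0]].
- lra.
- intros c Hc. apply gate_quotient_continuous. lra.
- assert (Hbig : forall s, 0 < s <= rho -> f s <= f s0).
  { intros s Hs. destruct (Rle_lt_dec (Rmin s1 s2) s) as [Hle|Hlt]; [apply Hmax; lra|].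
    assert (Hv0 : v <= f s0).
    { unfold v. rewrite u_GA_gate by easy. apply Hmax. split; [apply Rmin_l|lra]. }
    apply Rle_trans with (2 := Hv0).
    generalize (Rmin_r s1 s2); intros.
    assert (Hg : eps / v < gate rho s) by (rewrite <- E2; apply gate_decr; lra).
    assert (0 < / rho) by (apply Rinv_0_lt_compat; lra).
    assert (0 < eps / v) by (apply Rdiv_lt_0_compat; lra).
    unfold f. apply Rle_div_l; [lra|].
    assert (0 < s / (1 - s)) by (apply Rdiv_lt_0_compat; lra).
    assert (v * (eps / v) = eps) by (field; lra).
    nra. }
  exists (gate rho s0). split; [apply gate_ge_0; lra|].
  intros tau Htau. destruct (gate_surj tau Htau) as [s [Hs <-]].
  rewrite 2!u_GA_gate by lra. now apply Hbig.
Qed.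

(** Transfers optimality from [tau] to [s]. The optimal welfare is positive, hence
    [s / (1 - s) < eps] and [s < eps < rho]: the maximizer is interior and the derivative test
    applies. *)
Lemma sigma_star_spec (eps : R) : 0 < eps < rho ->
  0 < sigma_star rho (1 + eps) < eps /\
  u_GA_star rho (1 + eps)
    = (eps - sigma_star rho (1 + eps) / (1 - sigma_star rho (1 + eps)))
      / (/ rho + gate rho (sigma_star rho (1 + eps))) /\
  (forall s, 0 < s < rho ->
     (eps - s / (1 - s)) / (/ rho + gate rho s) <= u_GA_star rho (1 + eps)).
Proof.
intros He.
destruct (argmax_spec _ _ (u_GA_argmax_exists eps He)) as [Hd Hm].
fold (tau_star rho (1 + eps)) in Hd, Hm.
fold (u_GA_star rho (1 + eps)) in Hm.
destruct (gate_surj _ Hd) as [s [Hs E]].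
assert (Es : sigma_star rho (1 + eps) = s).
{ unfold sigma_star. rewrite <- E. now apply sigma_gate. }
assert (Eu : u_GA_star rho (1 + eps) = (eps - s / (1 - s)) / (/ rho + gate rho s)).
{ unfold u_GA_star. rewrite <- E. now apply u_GA_gate. }
rewrite Es.
split; [|split; [easy|]].
- split; [lra|].
  destruct (half_eps_feasible eps He) as [H1 H2].
  assert (Hpos : 0 < u_GA_star rho (1 + eps)).
  { apply Rlt_le_trans with (1 := u_GA_gate_pos _ _ H1 H2).
    apply Hm. now apply gate_ge_0. }
  rewrite Eu in Hpos.
  generalize (gate_ge_0 s Hs); intros.
  assert (0 < / rho) by (apply Rinv_0_lt_compat; lra).
  assert (Hlt : s / (1 - s) < eps).
  { apply Rnot_le_lt; intros Hle.
    assert ((eps - s / (1 - s)) / (/ rho + gate rho s) <= 0); [|lra].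
    apply Rle_div_l; lra. }
  apply Rlt_div_l in Hlt; nra.
- intros t Ht. rewrite <- u_GA_gate by lra. apply Hm, gate_ge_0. lra.
Qed.

Lemma sigma_star_first_order (eps : R) : 0 < eps < rho ->
  let s := sigma_star rho (1 + eps) in
  s * (/ rho + gate rho s) = gate_slope rho s * (eps - s / (1 - s)).
Proof.
intros He s.
destruct (sigma_star_spec eps He) as [Hs [Eu Hm]]. fold s in Hs, Eu.
rewrite Eu in Hm.
assert (HT : 0 <= gate rho s) by (apply gate_ge_0; lra).
assert (Hr : 0 < / rho) by (apply Rinv_0_lt_compat; lra).
set (f := fun s => (eps - s / (1 - s)) / (/ rho + gate rho s)).
assert (Hd : is_derive f s
  ((- / (1 - s) ^ 2 * (/ rho + gate rho s)
    - (eps - s / (1 - s)) * (- gate_slope rho s / (s * (1 - s) ^ 2)))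
   / (/ rho + gate rho s) ^ 2)).
{ assert (Hg := gate_is_derive s ltac:(lra)).
  unfold f. auto_derive.
  - repeat split; try lra. eexists; exact Hg.
  - replace (Derive (fun x => gate rho x) s) with (- gate_slope rho s / (s * (1 - s) ^ 2))
      by (symmetry; apply is_derive_unique, Hg).
    field. repeat split; nra. }
assert (H0 : derive_pt f s (ex_derive_Reals_0 f s (ex_intro _ _ Hd)) = 0).
{ apply deriv_maximum with 0 rho; try lra. intros x Hx0 Hx1. apply Hm. lra. }
rewrite Derive_Reals in H0.
apply is_derive_unique in Hd. rewrite H0 in Hd.
(* With [H = / rho + gate rho s], the vanishing derivative is the right side minus the left side of
   the goal, over [s * (1 - s) ^ 2 * H ^ 2]. *)
apply Rmult_eq_reg_r with (/ (s * (1 - s) ^ 2 * (/ rho + gate rho s) ^ 2)).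
- apply Rminus_diag_uniq_sym. etransitivity; [|symmetry; exact Hd].
  field. repeat split; nra.
- apply Rinv_neq_0_compat. apply Rmult_integral_contrapositive_currified;
    [apply Rmult_integral_contrapositive_currified|]; try apply pow_nonzero; lra.
Qed.

End Gate.

(** * Arithmetic of real limits along a filter *)

Section Real_limits.

Context {T : Type} {F : (T -> Prop) -> Prop} {FF : Filter F}.

Lemma filterlim_Rplus (f g : T -> R) (a b : R) :
  filterlim f F (locally a) -> filterlim g F (locally b) ->
  filterlim (fun x => f x + g x) F (locally (a + b)).
Proof.
intros Hf Hg.
exact (filterlim_comp_2 _ _ Rplus Hf Hg (filterlim_plus (V := R_NormedModule) a b)).
Qed.

Lemma filterlim_Rmult (f g : T -> R) (a b : R) :
  filterlim f F (locally a) -> filterlim g F (locally b) ->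
  filterlim (fun x => f x * g x) F (locally (a * b)).
Proof.
intros Hf Hg.
exact (filterlim_comp_2 _ _ Rmult Hf Hg (filterlim_mult (K := R_AbsRing) a b)).
Qed.

Lemma filterlim_continuous (f : T -> R) (phi : R -> R) (a : R) :
  filterlim f F (locally a) -> continuous phi a ->
  filterlim (fun x => phi (f x)) F (locally (phi a)).
Proof. intros Hf Hphi. exact (filterlim_comp _ _ _ f phi _ _ _ Hf Hphi). Qed.

Lemma filterlim_Rminus (f g : T -> R) (a b : R) :
  filterlim f F (locally a) -> filterlim g F (locally b) ->
  filterlim (fun x => f x - g x) F (locally (a - b)).
Proof.
intros Hf Hg. apply filterlim_Rplus; [easy|].
apply (filterlim_continuous g Ropp); [easy|].
apply (continuous_opp (V := R_NormedModule) (fun x => x)), continuous_id.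
Qed.

Lemma filterlim_Rdiv (f g : T -> R) (a b : R) :
  filterlim f F (locally a) -> filterlim g F (locally b) -> b <> 0 ->
  filterlim (fun x => f x / g x) F (locally (a / b)).
Proof.
intros Hf Hg Hb. apply filterlim_Rmult; [easy|].
apply (filterlim_continuous g Rinv); [easy|]. now apply continuous_Rinv.
Qed.

(** Lets the arithmetic rules build the limit as an unevaluated expression, simplified
    afterwards. *)
Lemma filterlim_locally_eq (f : T -> R) (a b : R) :
  filterlim f F (locally a) -> a = b -> filterlim f F (locally b).
Proof. now intros H <-. Qed.

(** Eventually the ratio exceeds [/ 2], and [g > Rmax 0 (2 * M)] then gives [f > M]. *)
Lemma filterlim_div_ge_1 (f g : T -> R) :
  filterlim (fun x => f x / g x) F (locally 1) ->
  filterlim g F (Rbar_locally p_infty) ->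
  filterlim f F (Rbar_locally p_infty).
Proof.
intros Hfg Hg P [M HM].
assert (H1 := Hfg _ (open_gt (/ 2) 1 ltac:(simpl; lra))).
assert (H2 : F (fun x => Rmax 0 (2 * M) < g x)) by (apply Hg; now exists (Rmax 0 (2 * M))).
unfold filtermap in *.
generalize (filter_and _ _ H1 H2). apply filter_imp. intros x [Hx1 Hx2].
apply HM.
generalize (Rmax_l 0 (2 * M)) (Rmax_r 0 (2 * M)); intros.
apply Rlt_div_r in Hx1; lra.
Qed.

End Real_limits.

(** * Logarithmic limits at 0 from the right *)

Lemma at_right_0_lt (a : R) : 0 < a -> at_right 0 (fun x => 0 < x < a).
Proof.
intros Ha. exists (mkposreal a Ha). intros x Hx Hx0. split; [easy|].
change (Rabs (x - 0) < a) in Hx. apply Rabs_def2 in Hx. lra.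
Qed.

Lemma filterlim_id_at_right_0 : filterlim (fun x : R => x) (at_right 0) (locally 0).
Proof. intros P [d Hd]. exists d. intros x Hx _. now apply Hd. Qed.

Lemma neg_ln_at_right_0 : filterlim (fun x => - ln x) (at_right 0) (Rbar_locally p_infty).
Proof.
intros P [M HM].
apply (is_lim_ln_0 (fun y => P (- y))). exists (- M). intros y Hy. apply HM. lra.
Qed.

Lemma inv_neg_ln_at_right_0 : filterlim (fun x => / - ln x) (at_right 0) (locally 0).
Proof.
apply (filterlim_comp _ _ _ _ Rinv _ _ _ neg_ln_at_right_0).
apply (filterlim_Rbar_inv p_infty). easy.
Qed.

Lemma ln_neg_ln_at_right_0 :
  filterlim (fun x => ln (- ln x) / - ln x) (at_right 0) (locally 0).
Proof.
exact (filterlim_comp _ _ _ _ (fun y => ln y / y) _ _ _ neg_ln_at_right_0 is_lim_div_ln_p).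
Qed.

Lemma mult_ln_at_right_0 : filterlim (fun x => x * - ln x) (at_right 0) (locally 0).
Proof.
apply filterlim_ext_loc with (fun x => ln (/ x) / / x).
- generalize (at_right_0_lt 1 Rlt_0_1). apply filter_imp. intros x Hx.
  rewrite ln_Rinv by lra. field. lra.
- exact (filterlim_comp _ _ _ _ (fun y => ln y / y) _ _ _ filterlim_Rinv_0_right is_lim_div_ln_p).
Qed.

(** The iterated logarithm is negligible against the logarithm, so the denominator in the theorem
    may be traded for [- ln x]. *)
Lemma ln_iterated_equiv :
  filterlim (fun x => (ln (1 / x) + ln (ln (1 / x))) / - ln x) (at_right 0) (locally 1).
Proof.
apply filterlim_ext_loc with (fun x => 1 + ln (- ln x) / - ln x).
- generalize (at_right_0_lt 1 Rlt_0_1). apply filter_imp. intros x Hx.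
  unfold Rdiv at 3 4. rewrite Rmult_1_l, ln_Rinv by lra.
  assert (ln x < 0) by (apply ln_neg; lra).
  field. lra.
- apply filterlim_locally_eq with (1 + 0); [|ring].
  apply filterlim_Rplus; [apply filterlim_const|apply ln_neg_ln_at_right_0].
Qed.

(** The factor [R] of the overview: the first-order condition solved for [eps] and divided by
    [s * - ln s]. *)
Definition gate_ratio (rho s : R) : R :=
  (/ rho + gate rho s) / - ln s / gate_slope rho s + / - ln s / (1 - s).

(** * Asymptotics of the gated optimum *)

Section Asymptotics.

Variable rho : R.
Hypothesis Hrho : 0 < rho < 1.

Lemma ln_factor_lim :
  filterlim (fun s => ln (rho / (rho + 1 - s))) (at_right 0) (locally (ln (rho / (rho + 1)))).
Proof.
apply filterlim_locally_eq with (ln (rho / (rho + 1 - 0))); [|now rewrite Rminus_0_r].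
apply (filterlim_continuous (fun s => s) (fun s => ln (rho / (rho + 1 - s)))).
- apply filterlim_id_at_right_0.
- apply (ex_derive_continuous (fun s => ln (rho / (rho + 1 - s)))).
  auto_derive. repeat split; [lra|]. apply Rdiv_lt_0_compat; lra.
Qed.

(** The logarithm of [s] occurs only multiplied by [s], and [s * - ln s] tends to 0. *)
Lemma gate_slope_lim : filterlim (gate_slope rho) (at_right 0) (locally 1).
Proof.
apply filterlim_ext with
  (fun s => (1 - s) * (1 - s / (rho + 1 - s))
            - (s * ln (rho / (rho + 1 - s)) + s * - ln s)).
{ intros s. unfold gate_slope, Rdiv. ring. }
eapply filterlim_locally_eq.
- apply filterlim_Rminus.
  + apply filterlim_Rmult.
    * apply filterlim_Rminus; [apply filterlim_const|apply filterlim_id_at_right_0].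
    * apply filterlim_Rminus; [apply filterlim_const|].
      apply filterlim_Rdiv; [apply filterlim_id_at_right_0| |].
      apply filterlim_Rminus; [apply filterlim_const|apply filterlim_id_at_right_0].
      lra.
  + apply filterlim_Rplus; [|apply mult_ln_at_right_0].
    apply filterlim_Rmult; [apply filterlim_id_at_right_0|apply ln_factor_lim].
- field. lra.
Qed.

(** Only [- ln s / (1 - s)] is unbounded near 0; every other term is killed by [/ - ln s]. *)
Lemma gate_lim : filterlim (fun s => (/ rho + gate rho s) / - ln s) (at_right 0) (locally 1).
Proof.
apply filterlim_ext_loc with
  (fun s => / rho * / - ln s + (ln (rho / (rho + 1 - s)) * / - ln s + 1) / (1 - s)).
{ generalize (at_right_0_lt 1 Rlt_0_1). apply filter_imp. intros s Hs. unfold gate.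
  assert (ln s < 0) by (apply ln_neg; lra).
  field. lra. }
eapply filterlim_locally_eq.
- apply filterlim_Rplus.
  + apply filterlim_Rmult; [apply filterlim_const|apply inv_neg_ln_at_right_0].
  + apply filterlim_Rdiv.
    * apply filterlim_Rplus; [|apply filterlim_const].
      apply filterlim_Rmult; [apply ln_factor_lim|apply inv_neg_ln_at_right_0].
    * apply filterlim_Rminus; [apply filterlim_const|apply filterlim_id_at_right_0].
    * lra.
- field. lra.
Qed.

Lemma gate_ratio_lim : filterlim (gate_ratio rho) (at_right 0) (locally 1).
Proof.
eapply filterlim_locally_eq.
- apply filterlim_Rplus.
  + apply filterlim_Rdiv; [apply gate_lim|apply gate_slope_lim|lra].
  + apply filterlim_Rdiv; [apply inv_neg_ln_at_right_0| |].
    * apply filterlim_Rminus; [apply filterlim_const|apply filterlim_id_at_right_0].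
    * lra.
- field.
Qed.

Lemma sigma_star_ratio (eps : R) : 0 < eps < rho ->
  let s := sigma_star rho (1 + eps) in eps = s * - ln s * gate_ratio rho s.
Proof.
intros He s.
destruct (sigma_star_spec rho Hrho eps He) as [Hs _].
assert (Hf := sigma_star_first_order rho Hrho eps He).
fold s in Hs, Hf. cbv zeta in Hf.
assert (Hg : 0 < gate_slope rho s) by (apply gate_slope_pos; lra).
assert (Hl : ln s < 0) by (apply ln_neg; lra).
unfold gate_ratio.
transitivity (s * (/ rho + gate rho s) / gate_slope rho s + s / (1 - s)).
- rewrite Hf. field. lra.
- field. lra.
Qed.

(** The first-order condition [s H = A N] turns the quotient [N / H] into [s / A], so the welfare
    inherits the asymptotics of [sigma_star]. *)
Lemma u_GA_star_sigma (eps : R) : 0 < eps < rho ->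
  let s := sigma_star rho (1 + eps) in
  u_GA_star rho (1 + eps) = s / gate_slope rho s.
Proof.
intros He s.
destruct (sigma_star_spec rho Hrho eps He) as [Hs [Eu _]].
assert (Hf := sigma_star_first_order rho Hrho eps He).
fold s in Hs, Hf, Eu. cbv zeta in Hf. rewrite Eu.
assert (Hg : 0 < gate_slope rho s) by (apply gate_slope_pos; lra).
assert (HT : 0 <= gate rho s) by (apply gate_ge_0; lra).
assert (Hr : 0 < / rho) by (apply Rinv_0_lt_compat; lra).
apply Rmult_eq_reg_r with (gate_slope rho s * (/ rho + gate rho s)); [|nra].
transitivity (gate_slope rho s * (eps - s / (1 - s))).
- field. repeat split; nra.
- rewrite <- Hf. field. repeat split; nra.
Qed.

(** Squeezed between 0 and [eps]. The target is [at_right 0] because the limits composed with it are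
    one-sided. *)
Lemma sigma_star_at_right_0 :
  filterlim (fun eps => sigma_star rho (1 + eps)) (at_right 0) (at_right 0).
Proof.
intros P [d Hd]. unfold filtermap.
generalize (at_right_0_lt (Rmin rho d) (Rmin_case _ _ _ (proj1 Hrho) (cond_pos d))).
apply filter_imp. intros eps He.
generalize (Rmin_l rho d) (Rmin_r rho d); intros.
destruct (sigma_star_spec rho Hrho eps) as [Hs _]; [lra|].
apply Hd; [|lra].
change (Rabs (sigma_star rho (1 + eps) - 0) < d). apply Rabs_def1; lra.
Qed.

Lemma sigma_star_ln_lim :
  filterlim (fun eps => sigma_star rho (1 + eps) * - ln eps / eps) (at_right 0) (locally 1).
Proof.
(* With [l = - ln s], the identity [eps = s l R] gives [- ln eps = l - ln l - ln R]. Hence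
   [s * - ln eps / eps] equals [(l - ln l - ln R) / (l R)], which is [Q s]. *)
set (Q := fun s => (1 - ln (- ln s) / - ln s - ln (gate_ratio rho s) * / - ln s)
                   / gate_ratio rho s).
assert (HQ : filterlim Q (at_right 0) (locally 1)).
{ eapply filterlim_locally_eq.
  - apply filterlim_Rdiv; [|apply gate_ratio_lim|lra].
    apply filterlim_Rminus.
    + apply filterlim_Rminus; [apply filterlim_const|apply ln_neg_ln_at_right_0].
    + apply filterlim_Rmult; [|apply inv_neg_ln_at_right_0].
      apply (filterlim_continuous _ ln); [apply gate_ratio_lim|].
      apply (ex_derive_continuous ln). auto_derive. lra.
  - rewrite ln_1. field. }
apply filterlim_ext_loc with (fun eps => Q (sigma_star rho (1 + eps))).
- generalize (at_right_0_lt rho (proj1 Hrho)). apply filter_imp. intros eps He.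
  destruct (sigma_star_spec rho Hrho eps He) as [Hs _].
  generalize (sigma_star_ratio eps He). cbv zeta.
  set (s := sigma_star rho (1 + eps)) in *. intros E.
  assert (Hl : ln s < 0) by (apply ln_neg; lra).
  assert (Hsl : 0 < s * - ln s) by nra.
  assert (HR : 0 < gate_ratio rho s) by nra.
  assert (El : ln eps = ln s + ln (- ln s) + ln (gate_ratio rho s)).
  { rewrite E at 1. rewrite 2!ln_mult by lra. ring. }
  rewrite El. rewrite E at 1. unfold Q. field. repeat split; nra.
- exact (filterlim_comp _ _ _ _ Q _ _ _ sigma_star_at_right_0 HQ).
Qed.

Lemma sigma_star_equiv :
  equiv_at_0plus (fun eps => sigma_star rho (1 + eps))
                 (fun eps => eps / (ln (1 / eps) + ln (ln (1 / eps)))).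
Proof.
apply filterlim_ext_loc with
  (fun eps => sigma_star rho (1 + eps) * - ln eps / eps
              * ((ln (1 / eps) + ln (ln (1 / eps))) / - ln eps)).
- generalize (at_right_0_lt 1 Rlt_0_1). apply filter_imp. intros eps He.
  assert (ln eps < 0) by (apply ln_neg; lra).
  (* The sum of logarithms vanishes at some [eps] in [(0, 1)]. Removing its double inverse first
     avoids a side condition that it be nonzero. *)
  unfold Rdiv. rewrite Rinv_mult, Rinv_inv. field. lra.
- apply filterlim_locally_eq with (1 * 1); [|ring].
  apply filterlim_Rmult; [apply sigma_star_ln_lim|apply ln_iterated_equiv].
Qed.

Lemma u_GA_star_equiv :
  equiv_at_0plus (fun eps => u_GA_star rho (1 + eps))
                 (fun eps => eps / (ln (1 / eps) + ln (ln (1 / eps)))).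
Proof.
apply filterlim_ext_loc with
  (fun eps => sigma_star rho (1 + eps) / (eps / (ln (1 / eps) + ln (ln (1 / eps))))
              / gate_slope rho (sigma_star rho (1 + eps))).
- generalize (at_right_0_lt rho (proj1 Hrho)). apply filter_imp. intros eps He.
  rewrite u_GA_star_sigma by easy. unfold Rdiv. ring.
- apply filterlim_locally_eq with (1 / 1); [|field].
  apply filterlim_Rdiv; [apply sigma_star_equiv| |lra].
  exact (filterlim_comp _ _ _ _ _ _ _ _ sigma_star_at_right_0 gate_slope_lim).
Qed.

(** * Asymptotics of random routing *)

Lemma p_star_interior_eventually : at_right 0 (fun eps => 0 < eps /\ 1 - / sqrt (1 + eps) <= rho).
Proof.
generalize (at_right_0_lt rho (proj1 Hrho)). apply filter_imp. intros eps He.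
split; [easy|].
assert (Hs : 1 < sqrt (1 + eps)) by (apply sqrt_gt_1; lra).
assert (Hq : sqrt (1 + eps) * sqrt (1 + eps) = 1 + eps) by (apply sqrt_sqrt; lra).
(* With [r = sqrt (1 + eps) > 1], one has [1 - / r <= r ^ 2 - 1 = eps < rho]. *)
assert (/ sqrt (1 + eps) * sqrt (1 + eps) = 1) by (field; lra).
nra.
Qed.

Lemma sqrt_1_plus_lim : filterlim (fun eps => sqrt (1 + eps)) (at_right 0) (locally 1).
Proof.
apply filterlim_locally_eq with (sqrt (1 + 0)); [|now rewrite Rplus_0_r, sqrt_1].
apply (filterlim_continuous (fun e => e) (fun e => sqrt (1 + e))).
- apply filterlim_id_at_right_0.
- apply (ex_derive_continuous (fun e => sqrt (1 + e))). auto_derive. lra.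
Qed.

Lemma p_star_equiv :
  equiv_at_0plus (fun eps => p_star rho (1 + eps)) (fun eps => eps / (2 * rho)).
Proof.
(* Substituting [eps = r ^ 2 - 1] with [r = sqrt (1 + eps)] cancels the factor [r - 1], leaving no
   indeterminate form. *)
apply filterlim_ext_loc with (fun eps => 2 / (sqrt (1 + eps) * (sqrt (1 + eps) + 1))).
- generalize p_star_interior_eventually. apply filter_imp. intros eps [He Hle].
  rewrite p_star_eq by (easy || lra).
  assert (Hs : 1 < sqrt (1 + eps)) by (apply sqrt_gt_1; lra).
  assert (Hq : eps = sqrt (1 + eps) * sqrt (1 + eps) - 1) by (rewrite sqrt_sqrt; lra).
  set (r := sqrt (1 + eps)) in *. rewrite Hq. field. repeat split; nra.
- eapply filterlim_locally_eq.
  + apply filterlim_Rdiv; [apply filterlim_const| |].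
    * apply filterlim_Rmult; [apply sqrt_1_plus_lim|].
      apply filterlim_Rplus; [apply sqrt_1_plus_lim|apply filterlim_const].
    * lra.
  + field.
Qed.

Lemma u_RR_star_eventually :
  at_right 0 (fun eps => u_RR_star rho (1 + eps) = (sqrt (1 + eps) - 1) ^ 2).
Proof.
generalize p_star_interior_eventually. apply filter_imp. intros eps [He Hle].
apply u_RR_star_eq; easy || lra.
Qed.

Lemma u_RR_star_equiv :
  equiv_at_0plus (fun eps => u_RR_star rho (1 + eps)) (fun eps => eps ^ 2 / 4).
Proof.
apply filterlim_ext_loc with
  (fun eps => 2 / (sqrt (1 + eps) + 1) * (2 / (sqrt (1 + eps) + 1))).
- generalize (filter_and _ _ u_RR_star_eventually (at_right_0_lt 1 Rlt_0_1)).
  apply filter_imp. intros eps [-> He].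
  assert (Hs : 1 < sqrt (1 + eps)) by (apply sqrt_gt_1; lra).
  assert (Hq : eps = sqrt (1 + eps) * sqrt (1 + eps) - 1) by (rewrite sqrt_sqrt; lra).
  set (r := sqrt (1 + eps)) in *. rewrite Hq. field. repeat split; nra.
- assert (H : filterlim (fun eps => 2 / (sqrt (1 + eps) + 1)) (at_right 0) (locally 1)).
  { eapply filterlim_locally_eq.
    - apply filterlim_Rdiv; [apply filterlim_const| |].
      + apply filterlim_Rplus; [apply sqrt_1_plus_lim|apply filterlim_const].
      + lra.
    - field. }
  apply filterlim_locally_eq with (1 * 1); [|ring].
  now apply filterlim_Rmult.
Qed.

(** * The price of forgetting *)

Lemma PoF_equiv :
  equiv_at_0plus (fun eps => PoF rho (1 + eps))
                 (fun eps => 4 / (eps * (ln (1 / eps) + ln (ln (1 / eps))))).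
Proof.
apply filterlim_ext_loc with
  (fun eps => u_GA_star rho (1 + eps) / (eps / (ln (1 / eps) + ln (ln (1 / eps))))
              / (u_RR_star rho (1 + eps) / (eps ^ 2 / 4))).
- generalize (filter_and _ _ u_RR_star_eventually (at_right_0_lt 1 Rlt_0_1)).
  apply filter_imp. intros eps [Eu He].
  assert (Hs : 1 < sqrt (1 + eps)) by (apply sqrt_gt_1; lra).
  assert (u_RR_star rho (1 + eps) <> 0) by (rewrite Eu; apply pow_nonzero; lra).
  unfold PoF, Rdiv. rewrite !Rinv_mult, !Rinv_inv. field. lra.
- apply filterlim_locally_eq with (1 / 1); [|field].
  apply filterlim_Rdiv; [apply u_GA_star_equiv|apply u_RR_star_equiv|lra].
Qed.

Lemma PoF_comparison_at_right_0 :
  filterlim (fun eps => 4 / (eps * (ln (1 / eps) + ln (ln (1 / eps)))))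
            (at_right 0) (Rbar_locally p_infty).
Proof.
assert (H : filterlim (fun eps => eps * (ln (1 / eps) + ln (ln (1 / eps))) / 4)
              (at_right 0) (at_right 0)).
{ assert (H0 : filterlim (fun eps => eps * (ln (1 / eps) + ln (ln (1 / eps))) / 4)
              (at_right 0) (locally 0)).
  { apply filterlim_ext_loc with
      (fun eps => eps * - ln eps * ((ln (1 / eps) + ln (ln (1 / eps))) / - ln eps) / 4).
    - generalize (at_right_0_lt 1 Rlt_0_1). apply filter_imp. intros eps He.
      assert (ln eps < 0) by (apply ln_neg; lra).
      field. lra.
    - apply filterlim_locally_eq with (0 * 1 / 4); [|field].
      apply filterlim_Rdiv; [|apply filterlim_const|lra].
      apply filterlim_Rmult; [apply mult_ln_at_right_0|apply ln_iterated_equiv]. }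
  intros P HP. apply H0 in HP. unfold filtermap in *.
  (* A limit 0 alone would not fix the sign of the reciprocal. The logarithmic ratio tends to 1, so
     it is eventually positive and 0 is approached from the right. *)
  assert (Hp : at_right 0 (fun eps => 0 < (ln (1 / eps) + ln (ln (1 / eps))) / - ln eps)).
  { apply (ln_iterated_equiv (fun y => 0 < y)). apply open_gt. exact Rlt_0_1. }
  generalize (filter_and _ _ (filter_and _ _ HP Hp) (at_right_0_lt 1 Rlt_0_1)).
  apply filter_imp. intros eps [[H1 H2] He]. apply H1.
  assert (ln eps < 0) by (apply ln_neg; lra).
  apply Rlt_div_r in H2; [|lra]. nra. }
apply filterlim_ext_loc with
  (fun eps => / (eps * (ln (1 / eps) + ln (ln (1 / eps))) / 4)).
- apply filter_forall. intros eps. unfold Rdiv at 1 4. now rewrite Rinv_mult, Rinv_inv, Rmult_comm.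
- exact (filterlim_comp _ _ _ _ _ _ _ _ H filterlim_Rinv_0_right).
Qed.

End Asymptotics.

Theorem proposition5 (rho : R) (Hrho : 0 < rho < 1) :
  (equiv_at_0plus (fun eps => p_star rho (1 + eps))
                  (fun eps => eps / (2 * rho)) /\
   at_right 0 (fun eps => u_RR_star rho (1 + eps) = (sqrt (1 + eps) - 1) ^ 2) /\
   equiv_at_0plus (fun eps => u_RR_star rho (1 + eps))
                  (fun eps => eps ^ 2 / 4))
  /\
  (equiv_at_0plus (fun eps => sigma_star rho (1 + eps))
                  (fun eps => eps / (ln (1 / eps) + ln (ln (1 / eps)))) /\
   equiv_at_0plus (fun eps => u_GA_star rho (1 + eps))
                  (fun eps => eps / (ln (1 / eps) + ln (ln (1 / eps)))))
  /\
  (equiv_at_0plus (fun eps => PoF rho (1 + eps))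
                  (fun eps => 4 / (eps * (ln (1 / eps) + ln (ln (1 / eps))))) /\
   filterlim (fun eps => PoF rho (1 + eps)) (at_right 0) (Rbar_locally p_infty)).
Proof.
split; [|split].
- split; [now apply p_star_equiv|split].
  + now apply u_RR_star_eventually.
  + now apply u_RR_star_equiv.
- split; [now apply sigma_star_equiv|now apply u_GA_star_equiv].
- split; [now apply PoF_equiv|].
  apply filterlim_div_ge_1 with (2 := PoF_comparison_at_right_0).
  now apply PoF_equiv.
Qed.
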